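(* Let $q=2^m$, $c_1\in\mathbb{F}_{q^2}$, $c_2,c_3\in\mathbb{F}_q$ and $\gamma\in\mathbb{F}_q^*$ be such that $1+\gamma\,\mathrm{Tr}_q^{q^2}(c_1)=\gamma$. Put $h_2(x)=\mathrm{Tr}_q^{q^2}\bigl(c_1x+c_2x^2+c_3x^3+c_3x^{q+2}+x^{2q-1}\bigr)$ and $f_2(x)=x+\gamma h_2(x)$. Then the compositional inverse of $f_2$ on $\mathbb{F}_{q^2}$ is $$f_2^{-1}(x)=\begin{cases}\gamma^{-1}x & \text{if } x\in\mathbb{F}_q,\\[6pt] x+h_2(x)+\dfrac{x^3+x^{3q}}{x^{q+1}} & \text{if } x\notin\mathbb{F}_q,\ \beta=0,\\[8pt] x+h_2(x)+\dfrac{x^3+x^{3q}}{x^{q+1}}+R+\dfrac{\beta}{R} & \text{if } x\notin\mathbb{F}_q,\ \beta\neq0,\ m\text{ odd},\\[8pt] x+h_2(x)+\dfrac{x^3+x^{3q}}{x^{q+1}}+\dfrac{\theta^{(q+2)/3}+\theta^{(2q+1)/3}}{\beta} & \text{if } x\notin\mathbb{F}_q,\ m\text{ even},\end{cases}$$ where (for $x\notin\mathbb{F}_q$) $$\beta=h_2(x)^2+(x+x^q)h_2(x)+\frac{(x+x^q)^6}{x^{2q+2}}+\frac{(x+x^q)^4}{x^{q+1}}+(x+x^q)^2+x^{q+1},$$ $$R=\Bigl(\beta\,(x+x^q)\sum_{i=0}^{(m-1)/2}\Bigl(\frac{\beta}{(x+x^q)^2}\Bigr)^{4^i}\Bigr)^{1/3}\quad(m\text{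 odd}),$$ and, in the last case, $\theta\in\mathbb{F}_{q^2}\setminus\mathbb{F}_q$ is either root of $\theta^2+\beta(x+x^q)\theta+\beta^3=0$ (both roots give the same value). Moreover, for $m$ even and $x\notin\mathbb{F}_q$ one always has $\beta\neq0$, so the four cases are exhaustive.
   Context: $m\ge1$ is an integer, $\mathbb{F}_q$ denotes the finite field with $q$ elements and $\mathbb{F}_q^*=\mathbb{F}_q\setminus\{0\}$. $\mathrm{Tr}_q^{q^2}:\mathbb{F}_{q^2}\to\mathbb{F}_q$ is the relative trace $\mathrm{Tr}_q^{q^2}(x)=x+x^q$. The compositional inverse $f^{-1}$ of a polynomial $f$ inducing a bijection of $\mathbb{F}_{q^2}$ is the inverse map $\mathbb{F}_{q^2}\to\mathbb{F}_{q^2}$. For $m$ odd, $(\cdot)^{1/3}$ denotes the unique cube root in $\mathbb{F}_q$, i.e. the inverse of the bijection $t\mapsto t^3$ of $\mathbb{F}_q$. *)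

(* Defs.v *)
From mathcomp Require Import all_boot all_order all_algebra all_fingroup all_field.
From mathcomp Require Import zify.

Set Implicit Arguments.
Unset Strict Implicit.
Unset Printing Implicit Defensive.

Import GRing.Theory.
Local Open Scope ring_scope.

Section Definitions.

(* L is the field with q ^ 2 elements, K its subfield with q elements. *)
Variables (L : finFieldType) (K : {pred L}) (q : nat).

Definition is_subfield_of_card : Prop := GRing.divring_closed K /\ #|K| = q.

(* The relative trace from L to K, with values seen in L. *)
Definition trq (x : L) : L := x + x ^+ q.

(* The cube root in K; cbrtP below shows that, for q = 2 ^ m with m odd, it is
   the inverse of the cube map on K (the default value 0 is then never used on
   K). *)
Definition cbrt (t : L) : L := odflt 0 [pick r in K | r ^+ 3 == t].

Variables (c1 c2 c3 : L).

Definition h2 (x : L) : L :=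
  trq (c1 * x + c2 * x ^+ 2 + c3 * x ^+ 3 + c3 * x ^+ (q + 2)%N
       + x ^+ (2 * q - 1)%N).

Definition f2 (gamma x : L) : L := x + gamma * h2 x.

Definition beta (x : L) : L :=
  h2 x ^+ 2 + (x + x ^+ q) * h2 x
  + (x + x ^+ q) ^+ 6 / x ^+ (2 * q + 2)%N
  + (x + x ^+ q) ^+ 4 / x ^+ (q + 1)%N
  + (x + x ^+ q) ^+ 2 + x ^+ (q + 1)%N.

Definition Rroot (m : nat) (x : L) : L :=
  cbrt (beta x * (x + x ^+ q)
        * \sum_(0 <= i < ((m - 1) %/ 2).+1)
             (beta x / (x + x ^+ q) ^+ 2) ^+ (4 ^ i)%N).

End Definitions.

Lemma subfield_expq (L : finFieldType) (K : {pred L}) (q : nat) :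
  is_subfield_of_card K q -> forall x, x \in K -> x ^+ q = x.
Proof.
case=> [[K1 KB Kdiv]] cardK x Kx.
have K0 : 0 \in K by rewrite -(subrr (1 : L)) KB.
have q_gt0 : (0 < q)%N by rewrite -cardK; apply/card_gt0P; exists 0.
have [->|x0] := eqVneq x 0; first by rewrite expr0n -[q]prednK.
have KM u v : u \in K -> v \in K -> u * v \in K.
  by move=> Ku Kv; rewrite -[v]invrK Kdiv // -[v^-1]mul1r Kdiv.
pose A := [pred y | (y \in K) && (y != 0)].
have cardA : #|A| = q.-1.
  rewrite -cardK (cardD1 0 K) K0 /=; apply: eq_card => y.
  by rewrite !inE andbC.
pose P := \prod_(y in A) y.
have P0 : P != 0 by apply/prodf_neq0 => y /andP[].
suff e : x ^+ q.-1 = 1 by rewrite -[q]prednK // exprS e mulr1.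
apply: (mulIf P0); rewrite mul1r /P -cardA -prodr_const -big_split /=.
rewrite [RHS](reindex_inj (mulfI x0)) /=; apply: eq_bigl => y.
rewrite !inE mulf_eq0 (negPf x0) /=; congr (_ && _).
apply/idP/idP => [Ky|Kxy]; first exact: KM.
by rewrite -(mulKf x0 y) mulrC Kdiv.
Qed.

Lemma cbrtP (L : finFieldType) (K : {pred L}) (m : nat) :
  is_subfield_of_card K (2 ^ m) -> odd m ->
  forall t, t \in K ->
    [/\ cbrt K t \in K, cbrt K t ^+ 3 = t & cbrt K (t ^+ 3) = t].
Proof.
move=> sK m_odd.
have Kq := subfield_expq sK; case: (sK) => [[K1 KB Kdiv]] _.
have KM u v : u \in K -> v \in K -> u * v \in K.
  by move=> Ku Kv; rewrite -[v]invrK Kdiv // -[v^-1]mul1r Kdiv.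
have KX u n : u \in K -> u ^+ n \in K.
  by move=> Ku; elim: n => [|n IH]; rewrite ?expr0 // exprS KM.
have [n En] : exists n, (3 * n = 2 * 2 ^ m - 1)%N.
  rewrite -(odd_double_half m) m_odd add1n expnS -mul2n expnM.
  elim: m./2 => [|k [n IH]]; first by exists 1%N.
  by exists (4 * n + 1)%N; rewrite expnS; lia.
have q_gt0 : (0 < 2 ^ m)%N by rewrite expn_gt0.
have E3n u : u \in K -> u ^+ (3 * n)%N = u.
  move=> Ku; rewrite En (_ : _ - 1 = 2 ^ m + (2 ^ m - 1))%N; last by lia.
  by rewrite exprD Kq // -exprS -addn1 subnK // Kq.
have cK t : t \in K -> cbrt K t \in K /\ cbrt K t ^+ 3 = t.
  move=> Kt; rewrite /cbrt; case: pickP => [r /andP[Kr /eqP] //|/(_ (t ^+ n))].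
  by rewrite KX // -exprM mulnC E3n // eqxx.
move=> t Kt; have [Kc Ec] := cK t Kt; split=> //.
have [Kd Ed] := cK _ (KX t 3 Kt).
by rewrite -[LHS]E3n // exprM Ed -exprM E3n.
Qed.

(* Main.v *)
Require Import Defs.
From mathcomp Require Import all_boot all_order all_algebra all_fingroup all_field.
From mathcomp Require Import ring zify.

Import GRing.Theory.
Local Open Scope ring_scope.

(** Write [K] for the field with [q] elements, [T = x + x^q] and [N = x^(q+1)]
    for the trace and norm of [x], and [h], [f] for [h2], [f2].

    On [K] every term of [h x] except [Tr(c1) x] is a trace of an element of
    [K], hence zero, so [f] is multiplication by [1 + gamma Tr(c1) = gamma].

    Outside [K], [h x = Tr(c1 x) + c2 T^2 + c3 T^3 + T^3/N + T] ([h2E]).  Since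
    [h] takes values in [K], a preimage of [y] has the form [x = y + a] with [a]
    in [K]; it has the same trace as [y], so only the linear term and [T^3/N]
    change ([h2Dr]).  By the hypothesis on [gamma], [f x = y] then says that
    [a + h y + T^3/N = T^3/N(y + a)], with [T] and [N] taken at [y].  Writing
    [a = h y + T^3/N + T + w] leaves the cubic
      [w^3 + beta w + T beta = 0]     ([f2_preimage]),
    and each case of the formula for the inverse exhibits its root in [K].

    Everything about that cubic follows from one fact ([beta_resolvent]):
    [beta / T^2 = z^2 + z + 1] for some [z] with [z^q = z + 1], so that [z] is
    outside [K].
    - There is at most one root in [K]. For [beta = 0] the only root is 0;
      otherwise two distinct roots [u], [v] would give [beta / T^2 = e^2 + e +
      1] with [e] rational in [u], [v]; then [z + e] is 0 or 1 and [z] would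
      be in [K] ([cubic_unique_root]). Hence [f] is injective, thus bijective.
    - Lagrange's resolvent: if [A^3] and [B^3] are the two roots of [t^2 +
      beta T t + beta^3] and [A B = beta], then [w = A + B] is a root of the
      cubic. Dividing by [beta T], the quadratic becomes [s^2 + s = z^2 + z +
      1].
    - For odd [m] it is solved in [K] by a sum of powers with exponents [4^i],
      which telescopes ([artin_schreier_sum]); cube roots exist in [K] and [w
      = R + beta / R] ([cubic_root_odd]).
    - For even [m] the primitive cube roots of unity are in [K], so the
      solutions [s], which differ from [z] by one of them, are outside [K].
      The roots [theta] and [theta^q] of the quadratic are conjugate, and the
      exponents [(q + 2)/3] and [(2q + 1)/3] select conjugate elements [A
      beta], [B beta] whose sum lies in [K] ([cubic_root_even]). *)

(** * Identities in characteristic two *)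

Section CharacteristicTwo.

Context {F : fieldType} (char2 : 2%N \in [pchar F]).

Lemma two_eq0 : 2 = 0 :> F. Proof. exact: pcharf0. Qed.

Lemma three_eq1 : 3 = 1 :> F.
Proof. by rewrite -[3%N]/(2 + 1)%N natrD two_eq0 add0r. Qed.

Lemma four_eq0 : 4 = 0 :> F.
Proof. by rewrite -[4%N]/(2 * 2)%N natrM two_eq0 mul0r. Qed.

Lemma oppr_eq1 : - 1 = 1 :> F. Proof. exact: oppr_pchar2. Qed.

(* Small coefficients are reduced modulo 2 by rewriting with these equations. *)
Local Ltac ring2 := ring: two_eq0 three_eq1 four_eq0 oppr_eq1.
Local Ltac field2 := field: two_eq0 three_eq1 four_eq0 oppr_eq1.

Lemma exprD_2power n (x y : F) :
  (x + y) ^+ (2 ^ n) = x ^+ (2 ^ n) + y ^+ (2 ^ n).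
Proof.
by apply: exprDn_pchar; rewrite pnatX (eq_pnat _ (pcharf_eq char2)) pnat_id.
Qed.

Lemma addr_eq0_char2 (x y : F) : (x + y == 0) = (x == y).
Proof. by rewrite addr_eq0 oppr_pchar2. Qed.

Lemma artin_schreier_root {z : F} : z ^+ 2 + z = 0 -> z = 0 \/ z = 1.
Proof.
move=> Ez; have /eqP : z * (z + 1) = 0 by rewrite -Ez; ring.
by rewrite mulf_eq0 addr_eq0_char2 => /orP[]/eqP; [left | right].
Qed.

(** The third root is [u + v], so [b = u^2 + u v + v^2] and
    [T b = u v (u + v)].  With [t = u / v] and [a = t^2 + t] this makes
    [b / T^2 = b^3 / (T b)^2 = (a + 1)^3 / a^2 = a + 1 + 1/a + 1/a^2], and
    [a] is itself of the form [t^2 + t]; thus [e = t + 1/a].  In a finite field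
    this is the statement that a split cubic has a resolvent of prescribed
    absolute trace. *)
Lemma cubic_two_roots {b T u v : F} : b != 0 -> T != 0 -> u != v ->
    u ^+ 3 + b * u + T * b = 0 -> v ^+ 3 + b * v + T * b = 0 ->
  let e := u / v + v ^+ 2 / (u * (u + v)) in b / T ^+ 2 = e ^+ 2 + e + 1.
Proof.
move=> b0 T0 neq_uv Eu Ev e.
have nz w : w ^+ 3 + b * w + T * b = 0 -> w != 0.
  apply: contra_eqN => /eqP->.
  by rewrite expr0n mulr0 !add0r mulf_neq0.
have [u0 v0] := (nz u Eu, nz v Ev).
have uv0 : u + v != 0 by rewrite addr_eq0_char2.
have Eb : b = u ^+ 2 + u * v + v ^+ 2.
  apply/(mulfI uv0)/eqP; rewrite -addr_eq0_char2; apply/eqP.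
  rewrite -[RHS]Eu -[LHS]addr0 -Ev; ring2.
have ETb : T * b = u * v * (u + v).
  apply/eqP; rewrite -addr_eq0_char2; apply/eqP; rewrite -Eu Eb; ring2.
have -> : b / T ^+ 2 = b ^+ 3 / (T * b) ^+ 2 by field; rewrite T0 b0.
pose t := u / v; pose a := t ^+ 2 + t.
have t0 : t != 0 by rewrite mulf_neq0 ?invr_eq0.
have Ea : a = u * (u + v) / v ^+ 2 by rewrite /a /t; field.
have a0 : a != 0 by rewrite Ea !mulf_neq0 ?invr_eq0 ?expf_neq0.
have -> : e = t + a^-1 by rewrite /e Ea /t; field; rewrite u0 v0 uv0.
have -> : (t + a^-1) ^+ 2 + (t + a^-1) + 1 = a + a^-1 ^+ 2 + a^-1 + 1.
  by move: (a^-1) => i; rewrite /a; ring2.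
have -> : b ^+ 3 / (T * b) ^+ 2 = (a + 1) ^+ 3 / a ^+ 2.
  by rewrite ETb Eb Ea; field; rewrite u0 v0 uv0.
by field2.
Qed.

(** Squaring [s] turns its exponents [4^i] into [2 * 4^i], so [s^2 + s] is the
    sum of all the [2^j]-th powers, [j < 2 k]; on [z^2 + z] that sum
    telescopes, and the constant [c] of the prime field occurs an even number
    of times. Both an element of trace zero ([c = 1], odd degree) and 1 itself
    ([c = 0], even degree) are written as [s^2 + s] in this way. *)
Lemma artin_schreier_sum (z c : F) k : c ^+ 2 = c ->
  let s := \sum_(i < k) (z ^+ 2 + z + c) ^+ (4 ^ i) in
  s ^+ 2 + s = z ^+ (4 ^ k) + z.
Proof.
move=> Ec /=; elim: k => [|k IH].
  rewrite big_ord0 expn0 expr1; ring2.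
rewrite big_ord_recr /=; set s := \sum_(i < k) _ in IH *.
have -> : (z ^+ 2 + z + c) ^+ (4 ^ k) = z ^+ (4 ^ k) ^+ 2 + z ^+ (4 ^ k) + c.
  have ck : c ^+ (4 ^ k) = c.
    elim: (k) => // j IHj; rewrite expnS mulnC exprM IHj.
    by rewrite (exprM c 2 2) !Ec.
  by rewrite -[4%N]/(2 ^ 2)%N -expnM !exprD_2power expnM ck exprAC.
have -> : z ^+ (4 ^ k.+1) = z ^+ (4 ^ k) ^+ 4 by rewrite expnSr exprM.
set t := z ^+ (4 ^ k) in IH *.
have -> : (s + (t ^+ 2 + t + c)) ^+ 2 + (s + (t ^+ 2 + t + c))
  = (s ^+ 2 + s) + (t ^+ 4 + t) + (c ^+ 2 + c) by ring2.
rewrite IH Ec; ring2.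
Qed.

End CharacteristicTwo.

(** * The quadratic extension and its subfield *)

Section QuadraticExtension.

Context {m : nat} {L : finFieldType} {K : {pred L}}.
Let q := (2 ^ m)%N.
Hypothesis cardL : #|L| = (q ^ 2)%N.
Hypothesis subK : is_subfield_of_card K q.

Lemma char2L : 2%N \in [pchar L].
Proof. by apply: (@card_finPcharP _ _ (m * 2)); rewrite // cardL -expnM. Qed.

Let two0 := two_eq0 char2L.
Let three1 := three_eq1 char2L.
Let four0 := four_eq0 char2L.
Let opp1 := oppr_eq1 char2L.
Local Ltac ring2 := ring: two0 three1 four0 opp1.
Local Ltac field2 := field: two0 three1 four0 opp1.

Lemma conjD (x y : L) : (x + y) ^+ q = x ^+ q + y ^+ q.
Proof. exact: exprD_2power char2L _ _ _. Qed.

Lemma conjK (x : L) : x ^+ q ^+ q = x.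
Proof. by rewrite -exprM mulnn -cardL expf_card. Qed.

(** [K] fills the set of roots of [X^q - X], which has at most [q] elements. *)
Lemma subfieldE (x : L) : (x \in K) = (x ^+ q == x).
Proof.
have q_gt1 : (1 < q)%N.
  have: (1 < #|L|)%N := finNzRing_gt1 L.
  by rewrite cardL; case: (q) => [|[|]].
pose p : {poly L} := 'X^q - 'X.
have szp : size p = q.+1.
  by rewrite size_polyDl size_polyXn // size_polyN size_polyX.
have rootP y : root p y = (y ^+ q == y).
  by rewrite /root !hornerE subr_eq0.
rewrite -rootP; apply/idP/idP=> [Kx|rx].
  by rewrite rootP (subfield_expq subK).
(* A root outside K, added to the elements of K, would be one root too many. *)
apply: contraT => xK.
have := @max_poly_roots _ p (x :: enum K).
rewrite -size_poly_eq0 szp /= mem_enum xK enum_uniq -cardE rx (proj2 subK).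
rewrite ltnn; apply=> //; apply/allP=> y; rewrite mem_enum => Ky.
by rewrite rootP (subfield_expq subK).
Qed.

Lemma subfieldP {x : L} : x \in K -> x ^+ q = x.
Proof. exact: subfield_expq. Qed.

Lemma subfieldD {x y : L} : x \in K -> y \in K -> x + y \in K.
Proof. by move=> Kx Ky; rewrite subfieldE conjD !subfieldP. Qed.

Lemma subfieldM {x y : L} : x \in K -> y \in K -> x * y \in K.
Proof. by move=> Kx Ky; rewrite subfieldE exprMn !subfieldP. Qed.

Lemma subfieldV {x : L} : x \in K -> x^-1 \in K.
Proof. by move=> Kx; rewrite subfieldE exprVn subfieldP. Qed.

Lemma subfieldX {x : L} n : x \in K -> x ^+ n \in K.
Proof. by move=> Kx; rewrite subfieldE exprAC subfieldP. Qed.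

Lemma subfieldDl {x y : L} : y \in K -> (x + y \in K) = (x \in K).
Proof.
move=> Ky; apply/idP/idP => [Kxy|Kx]; last exact: subfieldD.
have -> : x = x + y + y by ring2.
exact: subfieldD.
Qed.

Lemma subfield0 : 0 \in K.
Proof. by rewrite subfieldE expr0n expn_eq0. Qed.

Lemma subfield1 : 1 \in K.
Proof. by rewrite subfieldE expr1n. Qed.

Lemma subfield_trq (x : L) : trq q x \in K.
Proof. by rewrite subfieldE conjD conjK addrC. Qed.

Lemma trq_subfield {x : L} : x \in K -> trq q x = 0.
Proof. by move=> Kx; rewrite /trq subfieldP // addrr_pchar2 // char2L. Qed.

Lemma trqD (x y : L) : trq q (x + y) = trq q x + trq q y.
Proof. by rewrite /trq conjD; ring. Qed.

Lemma trqMr {x y : L} : y \in K -> trq q (x * y) = trq q x * y.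
Proof. by move=> Ky; rewrite /trq exprMn (subfieldP Ky); ring. Qed.

Lemma trq_eq0 (x : L) : (trq q x == 0) = (x \in K).
Proof. by rewrite addr_eq0_char2 ?char2L // eq_sym subfieldE. Qed.

Definition relnorm (x : L) : L := x * x ^+ q.

Lemma subfield_relnorm (x : L) : relnorm x \in K.
Proof. by rewrite subfieldE exprMn conjK mulrC. Qed.

Lemma relnorm_eq0 (x : L) : (relnorm x == 0) = (x == 0).
Proof. by rewrite mulf_eq0 expf_eq0 expn_gt0 /= orbb. Qed.

Lemma relnormDr (x a : L) : a \in K ->
  relnorm (x + a) = relnorm x + a * trq q x + a ^+ 2.
Proof. by move=> Ka; rewrite /relnorm /trq conjD (subfieldP Ka); ring. Qed.

Lemma notin_subfield_neq0 {x : L} : x \notin K -> x != 0.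
Proof. by apply: contraNneq => ->; apply: subfield0. Qed.

(** * The cubic [w^3 + b w + T b] and its resolvent *)

Section Resolvent.

Context {T z b : L}.
Hypotheses (KT : T \in K) (T0 : T != 0) (conjz : z ^+ q = z + 1).
Hypothesis Eb : b = T ^+ 2 * (z ^+ 2 + z + 1).

Lemma conj_shift_notin : z \notin K.
Proof. by rewrite subfieldE conjz -subr_eq0 addrAC subrr add0r oner_eq0. Qed.

Lemma subfield_resolvent : b \in K.
Proof.
rewrite Eb subfieldM ?subfieldX // subfieldE !conjD expr1n exprAC conjz.
by apply/eqP; ring2.
Qed.

(** Two distinct roots would make [z + e] a solution of [t^2 + t = 0] for some
    [e] in [K], and so put [z] in [K]. *)
Lemma cubic_unique_root {u v : L} : u \in K -> v \in K ->
  u ^+ 3 + b * u + T * b = 0 -> v ^+ 3 + b * v + T * b = 0 -> u = v.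
Proof.
move=> Ku Kv Eu Ev; apply/eqP.
have [b0|b0] := eqVneq b 0.
  have cube0 w : w ^+ 3 + b * w + T * b = 0 -> w = 0.
    by rewrite b0 mul0r mulr0 !addr0 => /eqP; rewrite expf_eq0 => /eqP.
  by rewrite (cube0 u Eu) (cube0 v Ev).
apply: contraT => neq_uv.
have := cubic_two_roots char2L b0 T0 neq_uv Eu Ev.
set e := _ + _ => /= Ebe.
have Ke : e \in K.
  apply: subfieldD; first exact: subfieldM (subfieldV Kv).
  by apply/subfieldM/subfieldV/subfieldM/subfieldD => //; apply: subfieldX.
have Eze : (z + e) ^+ 2 + (z + e) = 0.
  have : z ^+ 2 + z + 1 = e ^+ 2 + e + 1 by rewrite -Ebe Eb; field.
  move=> /(congr1 (+%R (e ^+ 2 + e + 1))) E.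
  rewrite -[RHS](addrr_pchar2 char2L (e ^+ 2 + e + 1)) -E; ring2.
have: z + e \in K.
  case: (artin_schreier_root char2L Eze) => ->; first exact: subfield0.
  exact: subfield1.
by rewrite subfieldDl // (negPf conj_shift_notin).
Qed.

(** The sum [s] satisfies [s^2 + s = b / T^2]: there are [(m + 1) / 2] terms, so
    the telescoped value is [z^(2 q) + z = (z + 1)^2 + z].  Hence [t = b T s] is
    a root of the resolvent [t^2 + b T t + b^3], the other root being
    [b^3 / t], and the cube roots [R], [b / R] of the two add up to a root of
    the cubic. *)
Lemma cubic_root_odd : odd m -> b != 0 ->
  let R := cbrt K (b * T *
             \sum_(0 <= i < ((m - 1) %/ 2).+1) (b / T ^+ 2) ^+ (4 ^ i)%N) in
  [/\ R != 0, R + b / R \in K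
    & (R + b / R) ^+ 3 + b * (R + b / R) + T * b = 0].
Proof.
move=> m_odd b0; set k := ((m - 1) %/ 2)%N.
have Em : (m.+1 = 2 * k.+1)%N by rewrite /k; lia.
have Kb := subfield_resolvent.
rewrite big_mkord; set s := \sum_(i < _) _; set t := b * T * s => R.
have Ks : s \in K.
  rewrite /s; elim/big_ind: _ => [|x y|i _]; first exact: subfield0.
    exact: subfieldD.
  by rewrite subfieldX ?subfieldM ?subfieldV ?subfieldX.
have Es : s ^+ 2 + s = b / T ^+ 2.
  have Ez : b / T ^+ 2 = z ^+ 2 + z + 1 by rewrite Eb; field.
  rewrite /s Ez artin_schreier_sum ?char2L ?expr1n //.
  rewrite -[4%N]/(2 ^ 2)%N -expnM -Em expnSr exprM conjz; ring2.
have Kt : t \in K by rewrite !subfieldM.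
have [KR ER _] := cbrtP subK m_odd Kt.
have Et : t ^+ 2 + b * T * t = b ^+ 3.
  rewrite (_ : _ + _ = (b * T) ^+ 2 * (s ^+ 2 + s)); last by rewrite /t; ring.
  by rewrite Es; field.
have t0 : t != 0.
  apply: contraNneq b0 => Et0; move/eqP: Et.
  by rewrite Et0 mulr0 expr0n addr0 eq_sym expf_eq0.
have R0 : R != 0 by apply: contraNneq t0 => ER0; rewrite -ER -/R ER0 expr0n.
split; rewrite ?subfieldD ?subfieldM ?subfieldV //.
rewrite (_ : _ + _ + _ = (R ^+ 3 ^+ 2 + b * T * R ^+ 3 + b ^+ 3) / R ^+ 3).
  by rewrite ER Et addrr_pchar2 ?char2L ?mul0r.
by field2.
Qed.

(** A primitive cube root of unity lies in the field with 4 elements, which is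
    contained in the field with [2^m] elements when [m] is even. *)
Lemma cube_root_unity_conj {w : L} :
  ~~ odd m -> w ^+ 2 + w + 1 = 0 -> w ^+ q = w.
Proof.
move=> m_even Ew.
have E4 : w ^+ 4 = w.
  have E2 : w ^+ 2 = w + 1.
    by apply/eqP; rewrite -subr_eq0 -Ew; apply/eqP; ring2.
  by rewrite (exprM w 2 2) E2 -[RHS]addr0 -Ew; ring2.
rewrite /q -(odd_double_half m) (negPf m_even) add0n -mul2n expnM.
by elim: m./2 => // k IH; rewrite expnS exprM E4.
Qed.

(** Otherwise [z] would be a primitive cube root of unity, hence in [K]. *)
Lemma resolvent_neq0 : ~~ odd m -> b != 0.
Proof.
move=> m_even; rewrite Eb mulf_neq0 ?expf_neq0 //; apply/eqP.
move/(cube_root_unity_conj m_even)/eqP; rewrite -subfieldE.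
by rewrite (negPf conj_shift_notin).
Qed.

(** Scaled by [b T], a root of the resolvent solves [s^2 + s = z^2 + z + 1], so
    [s + z] is a primitive cube root of unity and is fixed by conjugation; thus
    conjugation acts on [s] as on [z], adding 1. *)
Lemma resolvent_root_conj {th : L} : ~~ odd m ->
  th ^+ 2 + b * T * th + b ^+ 3 = 0 -> th ^+ q = th + b * T.
Proof.
move=> m_even Eth; have b0 := resolvent_neq0 m_even.
have Kb := subfield_resolvent.
pose w := th / (b * T) + z.
have Eth' : th = (w + z) * (b * T).
  rewrite (_ : w + z = th / (b * T)); last by rewrite /w; ring2.
  by rewrite divfK ?mulf_neq0.
have /(cube_root_unity_conj m_even) conjw : w ^+ 2 + w + 1 = 0.
  apply: (mulfI (expf_neq0 2 (mulf_neq0 b0 T0))).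
  (* Only the last factor of [b ^+ 3] is expanded: the factor [b ^+ 2] is
     common to all terms. *)
  rewrite mulr0 -Eth Eth' (exprSr b 2) {6}Eb; ring2.
rewrite Eth' exprMn conjD conjw conjz (subfieldP (subfieldM Kb KT)); ring.
Qed.

(** The trace one element [z^2 + z] yields a primitive cube root of unity [w],
    and [w + z] solves [s^2 + s = z^2 + z + 1]. *)
Lemma exists_resolvent_root : ~~ odd m ->
  exists th : L, th ^+ 2 + b * T * th + b ^+ 3 = 0.
Proof.
move=> m_even.
pose w := \sum_(i < m./2) (z ^+ 2 + z) ^+ (4 ^ i).
have Ew : w ^+ 2 + w = 1.
  have := artin_schreier_sum char2L z 0 m./2 (expr0n _ _).
  rewrite addr0 /= -/w => ->.
  have -> : (4 ^ m./2 = q)%N.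
    by rewrite -[4%N]/(2 ^ 2)%N -expnM mul2n even_halfK.
  by rewrite conjz; ring2.
exists ((w + z) * (b * T)).
have -> : ((w + z) * (b * T)) ^+ 2 + b * T * ((w + z) * (b * T)) + b ^+ 3
  = b ^+ 2 * (T ^+ 2 * (w ^+ 2 + w + (z ^+ 2 + z)) + b) by ring2.
by rewrite Ew {2}Eb; ring2.
Qed.

(** Let [A], [B] be the two powers of [th]. Since [th^(q+1) = b^3], they
    satisfy [A^3 = b^3 th], [B^3 = b^3 th^q] and [A B = b^3], so [A / b] and
    [B / b] are matching cube roots of the two roots of the resolvent.
    Moreover they are conjugate: [A^q = B th^((q^2 - 1)/3)], and this last
    factor is [b^(q - 1) = 1]. *)
Lemma cubic_root_even {th : L} : ~~ odd m ->
    th ^+ 2 + b * T * th + b ^+ 3 = 0 ->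
  let w := (th ^+ ((q + 2) %/ 3) + th ^+ ((2 * q + 1) %/ 3)) / b in
  w \in K /\ w ^+ 3 + b * w + T * b = 0.
Proof.
move=> m_even Eth w; have b0 := resolvent_neq0 m_even.
have Kb := subfield_resolvent.
have conj_th := resolvent_root_conj m_even Eth.
have [n En] : exists n, q = (3 * n + 1)%N.
  rewrite /q -(odd_double_half m) (negPf m_even) add0n -mul2n expnM.
  elim: m./2 => [|k [n IH]]; first by exists 0%N.
  by exists (4 * n + 1)%N; rewrite expnS IH; lia.
have E1 : ((q + 2) %/ 3 = n + 1)%N by rewrite En; lia.
have E2 : ((2 * q + 1) %/ 3 = 2 * n + 1)%N by rewrite En; lia.
have norm_th : th * th ^+ q = b ^+ 3.
  by apply/eqP; rewrite -(addr_eq0_char2 char2L) -Eth conj_th; apply/eqP; ring.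
have unit_th : (th * th ^+ q) ^+ n = 1.
  rewrite norm_th -exprM; apply: (mulfI b0); rewrite mulr1 -exprS -addn1 -En.
  exact: subfieldP.
have conj_thE : th ^+ q = th ^+ (3 * n + 1) by rewrite -En.
have conjA : (th ^+ (n + 1)) ^+ q = th ^+ (2 * n + 1).
  rewrite exprAC -[RHS]mulr1 -unit_th exprMn mulrA -exprD.
  rewrite (_ : 2 * n + 1 + n = 3 * n + 1)%N -?conj_thE -?exprS ?addn1 //.
  by lia.
rewrite {}/w E1 E2; set A := th ^+ _ in conjA *; set B := th ^+ _ in conjA *.
have EA3 : A ^+ 3 = b ^+ 3 * th.
  by rewrite -norm_th conj_thE -exprM -exprS -exprSr; congr (_ ^+ _); lia.
have EB3 : B ^+ 3 = b ^+ 3 * (th + b * T).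
  rewrite -norm_th -conj_th conj_thE -exprM -exprS -exprD; congr (_ ^+ _); lia.
have EAB : A * B = b ^+ 3.
  by rewrite -norm_th conj_thE -exprS -exprD; congr (_ ^+ _); lia.
split.
  by rewrite subfieldM ?subfieldV // subfieldE conjD -conjA conjK addrC.
have -> : ((A + B) / b) ^+ 3 + b * ((A + B) / b) + T * b
    = (A ^+ 3 + B ^+ 3 + A * B * (A + B) + b ^+ 3 * (A + B) + b ^+ 4 * T)
      / b ^+ 3.
  by field2.
by rewrite EA3 EB3 EAB; field2.
Qed.

End Resolvent.

(** * The permutation and its inverse *)

Section Permutation.

Context {c1 c2 c3 gamma : L}.
Hypotheses (Kc2 : c2 \in K) (Kc3 : c3 \in K) (Kg : gamma \in K).
Hypotheses (g0 : gamma != 0) (Hg : 1 + gamma * trq q c1 = gamma).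

Local Notation h := (h2 q c1 c2 c3).
Local Notation f := (f2 q c1 c2 c3 gamma).
Local Notation T := (trq q).
Local Notation N := relnorm.
Local Notation s x := (h x + T x ^+ 3 / N x).

(** The terms in [c3] combine, since [x^3 + x^(q+2)] has trace [T^3] in
    characteristic two, and [x^(2q-1)] has trace
    [x^(2q)/x + x^2/x^q = (x^3 + x^(3q))/N]. *)
Lemma h2E (x : L) : x != 0 ->
  h x = T (c1 * x) + c2 * T x ^+ 2 + c3 * T x ^+ 3 + (T x ^+ 3 / N x + T x).
Proof.
move=> x0; have y0 : x ^+ q != 0 by rewrite expf_neq0.
have q_gt0 : (0 < q)%N by rewrite expn_gt0.
have Eq : x ^+ (2 * q - 1) = x ^+ q ^+ 2 / x.
  apply: (mulIf x0); rewrite divfK // -exprSr -exprM mulnC.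
  by congr (_ ^+ _); lia.
rewrite /h2 !trqD Eq exprD mulrC -!addrA; congr (_ + _).
rewrite /trq /N !exprMn exprVn !conjK.
rewrite (subfieldP Kc2) (subfieldP Kc3); set y := x ^+ q in y0 *.
by field2; rewrite x0 y0.
Qed.

Lemma subfield_h2 (x : L) : h x \in K.
Proof. exact: subfield_trq. Qed.

Lemma subfield_shift (x : L) : s x \in K.
Proof.
apply: subfieldD (subfield_h2 x) _; apply: subfieldM.
  exact/subfieldX/subfield_trq.
exact/subfieldV/subfield_relnorm.
Qed.

Lemma trqDr {x a : L} : a \in K -> T (x + a) = T x.
Proof. by move=> Ka; rewrite trqD (trq_subfield Ka) addr0. Qed.

Lemma h2Dr (x a : L) : x \notin K -> a \in K ->
  h (x + a) = h x + a * T c1 + T x ^+ 3 / N (x + a) + T x ^+ 3 / N x.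
Proof.
move=> xK Ka; have xaK : x + a \notin K by rewrite subfieldDl.
rewrite !h2E ?notin_subfield_neq0 // (trqDr Ka) mulrDr trqD (trqMr Ka); ring2.
Qed.

Lemma f2_subfield (x : L) : x \in K -> f x = gamma * x.
Proof.
move=> Kx; rewrite /f2 /h2 -!addrA trqD (trqMr Kx).
set u := (X in _ * x + trq q X); have Ku : u \in K.
  by rewrite !(subfieldD, subfieldM, subfieldX).
rewrite (trq_subfield Ku) addr0.
by rewrite -{1}[x]mul1r mulrA -mulrDl Hg.
Qed.

Lemma subfield_f2 (x : L) : (f x \in K) = (x \in K).
Proof. by rewrite subfieldDl // subfieldM // subfield_h2. Qed.

Lemma betaE (x : L) :
  beta q c1 c2 c3 x = N x + s x * T x + s x ^+ 2 + T x ^+ 2.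
Proof.
rewrite /beta -/(trq q x).
have -> : x ^+ (q + 1) = N x by rewrite addn1 exprS.
have -> : x ^+ (2 * q + 2) = N x ^+ 2.
  by rewrite -(mulnDr 2 q 1) mulnC exprM addn1 exprS.
by rewrite -exprVn; move: (N x)^-1 => n; ring2.
Qed.

(** With [a = s y + T y + w] the hypothesis on [gamma], in the form
    [a = gamma (1 + Tr(c1)) a], turns [f (y + a) = y] into
    [T y + w = T y ^+ 3 / N (y + a)], where [N (y + a)] is quadratic in [w]; the
    translation by [T y] removes the square term of the resulting cubic. *)
Lemma f2_preimage {y w : L} : y \notin K -> w \in K ->
  (f (y + s y + T y + w) == y) =
  (w ^+ 3 + beta q c1 c2 c3 y * w + T y * beta q c1 c2 c3 y == 0).
Proof.
move=> yK Kw; set a := s y + T y + w.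
have Ks := subfield_shift y.
have Ka : a \in K by exact: subfieldD (subfieldD Ks (subfield_trq y)) Kw.
have x0 : N (y + a) != 0.
  by rewrite relnorm_eq0 notin_subfield_neq0 // subfieldDl.
have -> : y + s y + T y + w = y + a by rewrite /a; ring.
have -> : f (y + a) = y + gamma * ((T y + w) + T y ^+ 3 / N (y + a)).
  have Ea : a = gamma * (1 + T c1) * a.
    by rewrite -[LHS]mul1r; congr (_ * _); rewrite mulrDr mulr1 -{1}Hg; ring2.
  rewrite /f2 h2Dr //; move: (_ ^-1) => n; rewrite {1}Ea /a; ring2.
rewrite -subr_eq0 addrAC subrr add0r mulf_eq0 (negPf g0) /=.
rewrite addr_eq0_char2 ?char2L // -(inj_eq (mulIf x0)) divfK //.
rewrite -(addr_eq0_char2 char2L) relnormDr // betaE /a.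
have -> : (s y + T y + w) ^+ 2 = s y ^+ 2 + T y ^+ 2 + w ^+ 2 by ring2.
congr (_ == 0); ring2.
Qed.

(** [beta = N + s T + s^2 + T^2], and [x] is a root of [X^2 + T X + N]; dividing
    by [T^2], both [N / T^2] and [s / T + (s / T)^2] have the form [t^2 + t]. *)
Lemma beta_resolvent {x : L} : x \notin K ->
  exists2 z : L, z ^+ q = z + 1
    & beta q c1 c2 c3 x = T x ^+ 2 * (z ^+ 2 + z + 1).
Proof.
move=> xK; have T0 : T x != 0 by rewrite trq_eq0.
have Ks := subfield_shift x.
exists ((x + s x) / T x).
  rewrite exprMn exprVn (subfieldP (subfield_trq x)) conjD (subfieldP Ks).
  have -> : x ^+ q = x + T x by rewrite /trq; ring2.
  by move: (s x) => u; field.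
rewrite betaE; move: (s x) => u.
have -> : N x = x ^+ 2 + x * T x by rewrite /relnorm /trq; ring2.
by field2.
Qed.

(** Two preimages of a point [y] outside [K] differ from [y] by elements of
    [K], hence give two roots in [K] of the same cubic. *)
Lemma f2_inj : injective f.
Proof.
move=> x1 x2 Ef; have [Kx1|x1K] := boolP (x1 \in K).
  have Kx2 : x2 \in K by rewrite -subfield_f2 -Ef subfield_f2.
  by apply: (mulfI g0); rewrite -!f2_subfield.
pose y := f x1; have yK : y \notin K by rewrite subfield_f2.
have [z conjz Eb] := beta_resolvent yK.
have root x : f x = y -> let w := x + y + s y + T y in
    w \in K /\ w ^+ 3 + beta q c1 c2 c3 y * w + T y * beta q c1 c2 c3 y = 0.
  move=> Efx w; have Kw : w \in K.
    apply: subfieldD (subfieldD _ (subfield_shift y)) (subfield_trq y).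
    rewrite -Efx /f2 addrA addrr_pchar2 ?char2L // add0r.
    by rewrite subfieldM ?subfield_h2.
  split=> //; apply/eqP; rewrite -f2_preimage //.
  have -> : y + s y + T y + w = x by rewrite /w; move: (s y) => u; ring2.
  by rewrite Efx.
have [[Kw1 Ew1] [Kw2 Ew2]] := (root _ (erefl : f x1 = y), root _ (esym Ef)).
have T0 : T y != 0 by rewrite trq_eq0.
have := cubic_unique_root T0 conjz Eb Kw1 Kw2 Ew1 Ew2.
by do 3!move/addIr.
Qed.

Lemma f2_inverse_at {y w : L} : y \notin K -> w \in K ->
    w ^+ 3 + beta q c1 c2 c3 y * w + T y * beta q c1 c2 c3 y = 0 ->
  f (y + h y + (y ^+ 3 + y ^+ (3 * q)) / y ^+ (q + 1) + w) = y.
Proof.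
move=> yK Kw Ew; have y0 := notin_subfield_neq0 yK.
have yq0 : y ^+ q != 0 by rewrite expf_neq0.
have -> : (y ^+ 3 + y ^+ (3 * q)) / y ^+ (q + 1) = T y ^+ 3 / N y + T y.
  rewrite addn1 (exprS y q) mulnC exprM /trq /relnorm.
  by move: (y ^+ q) yq0 => z z0; field2; rewrite y0 z0.
rewrite (_ : _ + w = y + s y + T y + w); last by ring.
by apply/eqP; rewrite f2_preimage // Ew.
Qed.

End Permutation.

End QuadraticExtension.

Theorem theorem4p6 (m q : nat) (hm : (1 <= m)%N) (hq : q = (2 ^ m)%N)
    (L : finFieldType) (hL : #|L| = (q ^ 2)%N)
    (K : {pred L}) (hK : is_subfield_of_card K q)
    (c1 c2 c3 gamma : L)
    (hc2 : c2 \in K) (hc3 : c3 \in K)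
    (hgK : gamma \in K) (hg0 : gamma != 0)
    (hgamma : 1 + gamma * trq q c1 = gamma) :
  let h x := h2 q c1 c2 c3 x in
  let b x := beta q c1 c2 c3 x in
  let R x := Rroot K q c1 c2 c3 m x in
  exists finv : L -> L,
    [/\ cancel (f2 q c1 c2 c3 gamma) finv,
        cancel finv (f2 q c1 c2 c3 gamma),
        forall x, x \in K -> finv x = gamma^-1 * x
      & forall x, x \notin K ->
        [/\ b x = 0 ->
              finv x = x + h x + (x ^+ 3 + x ^+ (3 * q)%N) / x ^+ (q + 1)%N,
            b x != 0 -> odd m ->
              R x != 0 /\
              finv x = x + h x + (x ^+ 3 + x ^+ (3 * q)%N) / x ^+ (q + 1)%N
                       + R x + b x / R x
          & ~~ odd m ->
              [/\ b x != 0,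
                  exists theta : L, theta \notin K /\
                    theta ^+ 2 + b x * (x + x ^+ q) * theta + b x ^+ 3 = 0
                & forall theta : L,
                    theta ^+ 2 + b x * (x + x ^+ q) * theta + b x ^+ 3 = 0 ->
                    theta \notin K /\
                    finv x =
                      x + h x + (x ^+ 3 + x ^+ (3 * q)%N) / x ^+ (q + 1)%N
                      + (theta ^+ ((q + 2) %/ 3)%N
                         + theta ^+ ((2 * q + 1) %/ 3)%N) / b x]]].
Proof.
subst q => h b R.
have inj_f := f2_inj hL hK hc2 hc3 hgK hg0 hgamma.
have finvE x y : f2 (2 ^ m) c1 c2 c3 gamma x = y -> invF inj_f y = x.
  by move=> <-; rewrite invF_f.
exists (invF inj_f).
split; [exact: invF_f | exact: f_invF | move=> x Kx | move=> x xK].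
  apply: finvE; rewrite (f2_subfield hL hK) //; last first.
    by rewrite (subfieldM hL hK) ?(subfieldV hL hK).
  by rewrite mulVKf.
have T0 : trq (2 ^ m) x != 0 by rewrite (trq_eq0 hL hK).
have KT := subfield_trq hL hK x.
have [z conjz Eb] := @beta_resolvent _ _ _ hL hK c1 c2 c3 _ xK.
have at_root w : w \in K -> w ^+ 3 + b x * w + trq (2 ^ m) x * b x = 0 ->
    invF inj_f x
    = x + h x + (x ^+ 3 + x ^+ (3 * 2 ^ m)%N) / x ^+ (2 ^ m + 1)%N + w.
  by move=> Kw Ew; apply/finvE/(f2_inverse_at hL hK).
split=> [b0 | b0 m_odd | m_even].
- by rewrite (at_root 0) ?addr0 ?(subfield0 hL hK) // b0 !mulr0 expr0n !addr0.
- have [R0 Kw Ew] := cubic_root_odd hL hK KT T0 conjz Eb m_odd b0.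
  by split=> //; rewrite (at_root _ Kw Ew) addrA.
have b0 := resolvent_neq0 hL hK T0 conjz Eb m_even.
have th_notin th : th ^+ 2 + b x * (x + x ^+ (2 ^ m)) * th + b x ^+ 3 = 0 ->
    th \notin K.
  move=> Eth; rewrite (subfieldE hL hK).
  rewrite (resolvent_root_conj hL hK KT T0 conjz Eb m_even Eth).
  by rewrite -subr_eq0 addrAC subrr add0r mulf_neq0.
split=> // [|th Eth].
  have [th Eth] := exists_resolvent_root hL conjz Eb m_even.
  by exists th; split; first exact: th_notin.
split; first exact: th_notin.
have [Kw Ew] := cubic_root_even hL hK KT T0 conjz Eb m_even Eth.
exact: at_root Kw Ew.
Qed.
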